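(* The Ehrhart polynomial of the polytope $\mathcal{P}(F)$, where $F$ is a forest on the vertex set $[n+1]$ with $l$ edges, is $$L_{\mathcal{P}(F)}(t)=(-1)^l\sum_{i=0}^l(-1)^i f_{F,i}\binom{t+i}{i},$$ where $f_{F,k}$ is the number of leaves of an $\mathcal{S}$-reduction tree $\mathcal{T}_F^{\mathcal{S}}$ with root labeled $F$ that are labeled by forests with $k$ edges.
   Context: Graphs have vertex set $[n+1]=\{1,\ldots,n+1\}$; an edge joining $i<j$ is written $(i,j)$. Let $e_1,\ldots,e_{n+1}$ be the coordinate vectors of $\mathbb{R}^{n+1}$. $\mathcal{P}(A_n^+)$ is the convex hull of the origin and the points $e_i-e_j$, $1\le i<j\le n+1$; $\mathcal{C}(G)$ is the cone of nonnegative combinations of the $e_i-e_j$ with $(i,j)\in E(G)$, $i<j$; and $\mathcal{P}(G)=\mathcal{P}(A_n^+)\cap\mathcal{C}(G)$. The Ehrhart polynomial of an integer polytope $\mathcal{P}\subset\mathbb{R}^{n+1}$ is $L_{\mathcal{P}}(t)=\#(t\mathcal{P}\cap\mathbb{Z}^{n+1})$, where $t\mathcal{P}=\{tx\mid x\in\mathcal{P}\}$. Reduction rule for graphs: given $G_0$ with $(i,j),(j,k)\in E(G_0)$, $i<j<k$, $G_0$ reduces to $G_1,G_2,G_3$ with $E(G_1)=E(G_0)\setminus\{(j,k)\}\cup\{(i,k)\}$, $E(G_2)=E(G_0)\setminus\{(i,j)\}\cup\{(i,k)\}$, $E(G_3)=E(G_0)\setminus\{(i,j)\}\setminus\{(j,k)\}\cup\{(i,k)\}$.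 An $\mathcal{S}$-reduction tree with root labeled $F$ is a rooted tree with nodes labeled by graphs, with root labeled $F$, in which every node whose label admits a reduction has three children labeled by the graphs $G_1,G_2,G_3$ resulting from one chosen reduction of it, and whose leaves are labeled by graphs to which no reduction can be applied. The number $f_{F,k}$ does not depend on the choice of the $\mathcal{S}$-reduction tree. *)

(* Defs.v *)
From HB Require Import structures.
From mathcomp Require Import all_boot all_order all_algebra.
From mathcomp Require Import boolp.

Set Implicit Arguments.
Unset Strict Implicit.
Unset Printing Implicit Defensive.

Import Order.TTheory GRing.Theory Num.Theory.

(* The vertex i of [n+1] = {1, ..., n+1} is represented by the ordinal i - 1.
   A graph is its set of edges, the edge joining i < j being the pair (i, j).
   Multiple edges are not represented: they never arise from a forest. *)
Definition edgeset (n : nat) := {set 'I_n.+1 * 'I_n.+1}.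

Definition is_graph (n : nat) (G : edgeset n) : Prop :=
  forall e, e \in G -> (e.1 < e.2)%N.

Definition adj (n : nat) (G : edgeset n) : rel 'I_n.+1 :=
  fun i j => ((i, j) \in G) || ((j, i) \in G).

(* [ucycle] also accepts closed walks i, j, i along a single edge, whence the
   bound on the length. *)
Definition is_forest (n : nat) (G : edgeset n) : Prop :=
  is_graph G /\ forall c : seq 'I_n.+1, (2 < size c)%N -> ~ ucycle (adj G) c.

Section Reduction.
Variable n : nat.
Implicit Types (G : edgeset n) (i j k : 'I_n.+1).

Definition reducible G i j k : bool :=
  [&& (i < j)%N, (j < k)%N, (i, j) \in G & (j, k) \in G].

Definition reduct1 G i j k : edgeset n := (G :\ (j, k)) :|: [set (i, k)].
Definition reduct2 G i j k : edgeset n := (G :\ (i, j)) :|: [set (i, k)].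
Definition reduct3 G i j k : edgeset n :=
  ((G :\ (i, j)) :\ (j, k)) :|: [set (i, k)].

Inductive S_reduction_tree : edgeset n -> Type :=
| S_leaf G : (forall i j k, ~~ reducible G i j k) -> S_reduction_tree G
| S_node G i j k : reducible G i j k ->
    S_reduction_tree (reduct1 G i j k) ->
    S_reduction_tree (reduct2 G i j k) ->
    S_reduction_tree (reduct3 G i j k) -> S_reduction_tree G.

Fixpoint leaves G (T : S_reduction_tree G) : seq (edgeset n) :=
  match T with
  | S_leaf G _ => [:: G]
  | S_node _ _ _ _ _ T1 T2 T3 => leaves T1 ++ leaves T2 ++ leaves T3
  end.

Definition forest_leaves G (T : S_reduction_tree G) (k : nat) : nat :=
  count (fun H : edgeset n => `[< is_forest H >] && (#|H| == k)) (leaves T).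

Let weight G := (\sum_(e in G) (n.+1 - (e.2 - e.1)))%N.

Let weight_sub G (H : edgeset n) i j k (e0 : 'I_n.+1 * 'I_n.+1) :
  (i < j < k)%N -> e0 \in G -> (e0.2 - e0.1 < k - i)%N ->
  H \subset (G :\ e0) :|: [set (i, k)] -> (weight H < weight G)%N.
Proof.
move=> /andP[ij jk] e0G lt_e0 sHG.
have ltk : (k - i < n.+1)%N by rewrite (leq_ltn_trans (leq_subr _ _)).
rewrite /weight [X in (_ < X)%N](big_setD1 e0) //=.
have le1 : (\sum_(e in H) (n.+1 - (e.2 - e.1)) <=
    \sum_(e in (i, k) |: (G :\ e0)) (n.+1 - (e.2 - e.1)))%N.
  have /setIidPr IH : H \subset (i, k) |: (G :\ e0) by rewrite setUC.
  by rewrite [X in (_ <= X)%N](big_setID H) /= IH leq_addr.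
apply: leq_ltn_trans le1 _; case: (boolP ((i, k) \in G :\ e0)) => h.
  rewrite (_ : (i, k) |: _ = G :\ e0); last by apply/setUidPr; rewrite sub1set.
  by rewrite -[X in (X < _)%N]add0n ltn_add2r subn_gt0 (ltn_trans lt_e0).
by rewrite big_setU1 //= ltn_add2r ltn_sub2l // (ltn_trans lt_e0).
Qed.

Lemma S_reduction_tree_exists G : inhabited (S_reduction_tree G).
Proof.
have [m] := ubnP (weight G); elim: m G => // m IHm G /ltnSE leGm.
have [[[i j] k] /= h|h] :=
    pickP (fun p : 'I_n.+1 * 'I_n.+1 * 'I_n.+1 => reducible G p.1.1 p.1.2 p.2).
  have /and4P[ij jk ijG jkG] := h.
  have ijk : (i < j < k)%N by rewrite ij jk.
  have lt1 : (k - j < k - i)%N by rewrite ltn_sub2l // (ltn_trans ij).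
  have lt2 : (j - i < k - i)%N by rewrite ltn_sub2r // (ltn_trans ij).
  have [T1] : inhabited (S_reduction_tree (reduct1 G i j k)).
    by apply/IHm/(leq_trans _ leGm)/(weight_sub ijk jkG lt1).
  have [T2] : inhabited (S_reduction_tree (reduct2 G i j k)).
    by apply/IHm/(leq_trans _ leGm)/(weight_sub ijk ijG lt2).
  have [T3] : inhabited (S_reduction_tree (reduct3 G i j k)).
    apply/IHm/(leq_trans _ leGm)/(weight_sub ijk ijG lt2).
    by apply: setSU; rewrite subD1set.
  by split; exact: (S_node h T1 T2 T3).
by split; apply: S_leaf => i j k; rewrite (h (i, j, k)).
Qed.

End Reduction.

From mathcomp Require Import finmap.
From mathcomp Require Import classical_sets functions cardinality reals convex.

Local Open Scope classical_set_scope.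
Local Open Scope ring_scope.

Section Polytopes.
Variables (R : realType) (n : nat).
Let V := 'rV[R]_n.+1.

Definition pos_root (e : 'I_n.+1 * 'I_n.+1) : V :=
  delta_mx ord0 e.1 - delta_mx ord0 e.2.

Definition conv_hull (A : set V) : set V :=
  smallest (@convex_set R 'rV[R]_n.+1) A.

Definition full_root_polytope : set V :=
  conv_hull ([set 0] `|`
    [set pos_root e | e in [set e : 'I_n.+1 * 'I_n.+1 | (e.1 < e.2)%N]]).

Definition root_cone (G : edgeset n) : set V :=
  [set x : V | exists c : 'I_n.+1 * 'I_n.+1 -> R,
    (forall e, 0 <= c e) /\ x = \sum_(e in G) c e *: pos_root e].

Definition root_polytope (G : edgeset n) : set V :=
  full_root_polytope `&` root_cone G.

Definition dilate (t : nat) (P : set V) : set V := [set t%:R *: x | x in P].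

Definition lattice : set V := [set x : V | forall i, x ord0 i \is a Num.int].

(* [fset_set] is empty on infinite sets, so this is the number of lattice
   points of the dilate only when there are finitely many of them. *)
Definition ehrhart (P : set V) (t : nat) : nat :=
  #|` fset_set (dilate t P `&` lattice)|%fset.

End Polytopes.

Arguments root_polytope R {n} G.
Arguments lattice R n : clear implicits.

(* Main.v *)
(* For a forest G the roots e_i - e_j of its edges are linearly independent and
   unimodular, and P(A_n^+) is cut out of the root cone by the inequality
   sum_v max(x_v, 0) <= 1.  A reduction splits the cone: C(G_0) is the union of
   C(G_1) and C(G_2), whose intersection is C(G_3); so the lattice points of
   the dilates satisfy L(G_0) = L(G_1) + L(G_2) - L(G_3).  At a leaf H every
   vertex is only a source or only a sink, the inequality reads
   sum of the coefficients <= t, and L(H) = binomial(t + k, k) with k = |E(H)|.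
   Since |E(G_1)| = |E(G_2)| = |E(G_0)| and |E(G_3)| = |E(G_0)| - 1, the sign of
   a leaf H is (-1)^(l - k). *)
From HB Require Import structures.
Require Import Defs.
From mathcomp Require Import all_boot all_order all_algebra.
From mathcomp Require Import classical_sets cardinality reals.
From mathcomp Require Import boolp finmap interval_inference convex.
From mathcomp Require Import ring lra.

Set Implicit Arguments.
Unset Strict Implicit.
Unset Printing Implicit Defensive.

Import Order.TTheory GRing.Theory Num.Theory.

Local Open Scope classical_set_scope.
Local Open Scope ring_scope.

(** * Vertices of degree one in a forest *)

Section LeafVertex.
Variables (n : nat) (G : edgeset n).
Implicit Types (x y v w : 'I_n.+1) (p : seq 'I_n.+1).

Lemma adj_sym : symmetric (adj G).
Proof. by move=> x y; rewrite /adj orbC. Qed.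

Lemma graph_irrefl (e : 'I_n.+1 * 'I_n.+1) :
  is_graph G -> e \in G -> e.1 != e.2.
Proof. by move=> gG /gG lt_e; rewrite neq_ltn lt_e. Qed.

Lemma graph_asym x y : is_graph G -> (x, y) \in G -> (y, x) \notin G.
Proof.
by move=> gG /gG /= xy; apply/negP => /gG /=; rewrite ltnNge (ltnW xy).
Qed.

(* A simple path that cannot be prolonged at its start [x] shows that [x] has
   degree one: a second neighbour of [x] lies on the path and closes a cycle. *)
Lemma path_leaf_vertex x p :
    is_forest G -> path (adj G) x p -> uniq (x :: p) -> p != [::] ->
  exists v w, adj G v w /\ forall u, adj G v u -> u = w.
Proof.
move=> [gG acyc]; have [m] := ubnP (n.+1 - size p)%N.
elim: m x p => // m IHm x [//|h q] /ltnSE le_m xp_path xp_uniq _.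
have [[y /andP[xy nyp]]|no_new] :=
    pselect (exists y, adj G x y && (y \notin x :: h :: q)).
  apply: (IHm y (x :: h :: q)) => //=; last 2 first.
  - by rewrite adj_sym xy.
  - by rewrite nyp.
  have := max_card [in x :: h :: q]; rewrite card_ord (card_uniqP xp_uniq) /=.
  by move=> lt_s; apply: leq_trans le_m; rewrite ltn_sub2l.
exists x, h; split; first by case/andP: xp_path.
move=> y xy; apply/eqP/negPn/negP => yh.
have yx : y != x.
  by apply/eqP => yx; case/orP: xy => /(graph_irrefl gG); rewrite yx eqxx.
have yq : y \in q.
  apply/negPn/negP => yq; apply: no_new; exists y.
  by rewrite xy !inE (negPf yx) (negPf yh).
case/splitPr: yq xp_path xp_uniq => q1 q2 /=.
rewrite cat_path /= => /and4P[xh hq1 yq1 _].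
rewrite inE mem_cat inE !negb_or mem_cat cat_uniq /= inE !negb_or -!andbA.
move=> /and5P[xNh xq1 xNy _ /and5P[hq1' hNy _ uq1 /and3P[yNq1 _ _]]].
apply: (acyc (x :: h :: rcons q1 y)); first by rewrite /= size_rcons.
rewrite /ucycle /= rcons_path last_rcons rcons_path xh hq1 yq1 /= adj_sym xy.
rewrite !inE !mem_rcons !inE !negb_or rcons_uniq.
by rewrite xNh xNy xq1 hNy hq1' yNq1 uq1.
Qed.

Definition incident v (e : 'I_n.+1 * 'I_n.+1) := (e.1 == v) || (e.2 == v).

(** Any edge is a simple path from which [path_leaf_vertex] finds a vertex with a single neighbour.
    That neighbour determines the edge, because [is_graph] rules out having both orientations. *)
Lemma forest_leaf_edge : is_forest G -> G != finset.set0 ->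
  exists v e, [/\ e \in G, incident v e &
    forall f, f \in G -> incident v f -> f = e].
Proof.
move=> fG /set0Pn[[a b] abG]; have gG := fG.1.
have ab := graph_irrefl gG abG.
have [|||//|v [w [vw w_uniq]]] := @path_leaf_vertex a [:: b].
- by [].
- by rewrite /= /adj abG.
- by rewrite /= inE ab.
have adjP f : f \in G -> incident v f -> f = (v, w) \/ f = (w, v).
  case: f => x y xyG; rewrite /incident /= => /orP[]/eqP xv; subst v.
    by left; rewrite (w_uniq y) // /adj xyG.
  by right; rewrite (w_uniq x) // /adj xyG orbT.
case/orP: vw => eG; [exists v, (v, w) | exists v, (w, v)]; split=> //.
- by rewrite /incident eqxx.
- move=> f fG' /(adjP f fG')[//|ff].
  by move: (graph_asym gG eG); rewrite -ff fG'.
- by rewrite /incident eqxx orbT.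
- move=> f fG' /(adjP f fG')[|//] ff.
  by move: (graph_asym gG eG); rewrite -ff fG'.
Qed.

End LeafVertex.

Lemma sub_is_forest n (G H : edgeset n) :
  H \subset G -> is_forest G -> is_forest H.
Proof.
move=> /fintype.subsetP sHG [gG acyc]; split=> [e /sHG/gG //|c c2 /andP[cH uc]].
apply: (acyc c c2); rewrite /ucycle uc andbT.
by apply: sub_cycle cH => x y /orP[] /sHG h; rewrite /adj h ?orbT.
Qed.

(** * Forests and linear independence of their roots *)

Section Combination.
Variables (R : realType) (n : nat).
Local Notation E := ('I_n.+1 * 'I_n.+1)%type.
Implicit Types (c d : {ffun E -> R^o}) (G H : edgeset n) (e : E).

(** Coefficients are indexed by all pairs of vertices, with [supported] restricting them to a graph,
    so that combinations over different graphs can be added and compared. *)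
Definition comb c : 'rV[R]_n.+1 := \sum_e c e *: pos_root R e.

Definition supported c G := forall e, e \notin G -> c e = 0.

Definition edge_delta e : {ffun E -> R^o} := [ffun f => (f == e)%:R].

Definition independent G :=
  forall c, supported c G -> comb c = 0 -> c = 0.

Fact comb_is_linear : linear comb.
Proof.
move=> a c d; rewrite /comb scaler_sumr -big_split; apply: eq_bigr => e _.
by rewrite !ffunE scalerDl scalerA.
Qed.
HB.instance Definition _ :=
  GRing.isLinear.Build R {ffun E -> R^o} 'rV[R]_n.+1 _ comb comb_is_linear.

Lemma comb_edge_delta e : comb (edge_delta e) = pos_root R e.
Proof.
rewrite /comb (bigD1 e) //= big1 => [|f /negPf fe].
  by rewrite ffunE eqxx scale1r addr0.
by rewrite ffunE fe scale0r.
Qed.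

Lemma pos_rootE e v : pos_root R e ord0 v = (e.1 == v)%:R - (e.2 == v)%:R.
Proof. by rewrite !mxE eqxx /= ![v == _]eq_sym. Qed.

Lemma combE c v :
  comb c ord0 v = \sum_e c e * ((e.1 == v)%:R - (e.2 == v)%:R).
Proof. by rewrite summxE; apply: eq_bigr => e _; rewrite mxE pos_rootE. Qed.

Lemma independent_inj G c d : independent G ->
  supported c G -> supported d G -> comb c = comb d -> c = d.
Proof.
move=> iG sc sd cd; apply/subr0_eq/iG; last by rewrite linearB /= cd subrr.
by move=> e eG; rewrite !ffunE sc ?sd ?subrr.
Qed.

(* Removing a leaf edge peels off one coefficient, which up to sign is the
   coordinate at the leaf. *)
Lemma forest_coef_in (P : {pred R}) G c : zmod_closed P -> is_forest G ->
  supported c G -> (forall v, comb c ord0 v \in P) -> forall e, c e \in P.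
Proof.
move=> zP; have P0 := zP.1; have PB := zP.2.
have PN x : x \in P -> - x \in P by move=> Px; rewrite -[- x]add0r PB.
have PD x y : x \in P -> y \in P -> x + y \in P.
  by move=> Px Py; rewrite -[y]opprK PB ?PN.
have [m] := ubnP #|G|; elim: m G c => // m IHm G c /ltnSE leGm fG sc cP.
have [G0|GN0] := eqVneq G finset.set0.
  by move=> e; rewrite sc // G0 inE.
have [v [e [eG ve e_uniq]]] := forest_leaf_edge fG GN0.
have e12 : e.1 != e.2 by apply: graph_irrefl eG; case: fG.
have ceP : c e \in P.
  have := cP v; rewrite combE (bigD1 e) //= big1 ?addr0 => [|f fe]; last first.
    have [fG'|/sc->] := boolP (f \in G); last by rewrite mul0r.
    have /negP : ~ incident v f.
      by move=> /(e_uniq f fG') /eqP; rewrite (negPf fe).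
    by rewrite negb_or => /andP[/negPf-> /negPf->]; rewrite subrr mulr0.
  case/orP: ve => /eqP ev; rewrite ev -ev eqxx.
    by rewrite eq_sym (negPf e12) subr0 mulr1.
  by rewrite (negPf e12) sub0r mulrN1 => /PN; rewrite opprK.
move=> f; have [->//|fe] := eqVneq f e.
pose d := c - c e *: edge_delta e.
have df : c f = d f by rewrite !ffunE (negPf fe) scaler0 subr0.
rewrite df; apply: (IHm (G :\ e)%SET) => //.
- by rewrite (cardsD1 e) eG in leGm.
- exact: sub_is_forest (subsetDl _ _) fG.
- move=> g; rewrite !inE negb_and negbK => /orP[/eqP->|gG].
    by rewrite !ffunE eqxx [_ *: _]mulr1 subrr.
  have ge : (g == e) = false by apply: contraNF gG => /eqP->.
  by rewrite !ffunE (sc g gG) ge scaler0 subr0.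
- move=> u; rewrite linearB linearZ /= comb_edge_delta !mxE eqxx /=.
  apply: PB; first exact: cP.
  by do 2!case: (_ == _); rewrite ?subrr ?subr0 ?sub0r ?mulr0 ?mulrN ?mulr1 ?PN.
Qed.

(** This is [forest_coef_in] for the subgroup zero. *)
Lemma forest_independent G : is_forest G -> independent G.
Proof.
move=> fG c sc c0; apply/ffunP => e; rewrite ffunE; apply/eqP.
apply: (@forest_coef_in (pred1 0) G c _ fG sc) => [|v].
  by split=> [|x y]; rewrite !inE // => /eqP-> /eqP->; rewrite subrr.
by rewrite c0 mxE inE.
Qed.

(** This is [forest_coef_in] for the integers, and expresses that the roots of a forest are
    unimodular. *)
Lemma forest_int_coef G c : is_forest G -> supported c G ->
  lattice R n (comb c) -> forall e, c e \is a Num.int.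
Proof.
move=> fG sc cP; apply: forest_coef_in fG sc cP.
by split=> [|x y]; [exact: rpred0|exact: rpredB].
Qed.

(* The edges of a cycle, signed by the direction in which it runs through
   them, give a nontrivial relation. *)
Lemma independent_forest G : is_graph G -> independent G -> is_forest G.
Proof.
move=> gG iG; split=> // p p2 /andP[cp up].
(* [N e] marks the steps of the cycle from [e.1] to [e.2], and [s] reverses a pair. Hence [c] is 1
   on edges run forwards and -1 on edges run backwards. *)
pose N e : R := ((e.1 \in p) && (next p e.1 == e.2))%:R.
pose s (e : E) : E := (e.2, e.1).
have sK : involutive s by case.
pose c : {ffun E -> R^o} := [ffun e => if e \in G then N e - N (s e) else 0].
have sc : supported c G by move=> e /negPf eG; rewrite ffunE eG.
have root_s e : pos_root R (s e) = - pos_root R e by rewrite /pos_root opprB.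
have c0 : comb c = 0.
  (* The part of [c] coming from backward steps is reindexed by [s]. Each step of the cycle is an
     edge in exactly one orientation, so the two parts add up to the sum of [N e *: pos_root R e]
     over all pairs. *)
  rewrite /comb (eq_bigr (fun e => (if e \in G then N e else 0) *: pos_root R e +
      (if s (s e) \in G then N (s e) else 0) *: pos_root R (s e))); last first.
    move=> e _; rewrite ffunE sK root_s; case: ifP => _;
      last by rewrite !scale0r addr0.
    by rewrite scalerBl scalerN.
  rewrite big_split /= -[X in _ + X](reindex_inj (inv_inj sK)
    (P := xpredT) (F := fun e => (if s e \in G then N e else 0) *: pos_root R e)) /=.
  rewrite -big_split /= (eq_bigr (fun e => N e *: pos_root R e)); last first.
    case=> a b _; rewrite -scalerDl; congr (_ *: _); rewrite /s /N /=.
    have [/= /andP[ap /eqP nb]|] := boolP (_ && _);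
      last by do 2!case: ifP; rewrite ?addr0.
    have : adj G a b by rewrite -nb; exact: next_cycle.
    rewrite /adj; case: ifP => [abG _|_ /= ->]; last by rewrite add0r.
    by rewrite (negPf (graph_asym gG abG)) addr0.
  rewrite -(pair_bigA _ (fun a b => N (a, b) *: pos_root R (a, b))) /=.
  rewrite (eq_bigr (fun a => if a \in p then pos_root R (a, next p a) else 0)); last first.
    move=> a _; rewrite /N /=; case: ifP => ap;
      last by rewrite big1 // => b _; rewrite scale0r.
    rewrite (bigD1 (next p a)) //= eqxx scale1r big1 ?addr0 // => b.
    by rewrite eq_sym => /negPf->; rewrite scale0r.
  (* The sum telescopes, since [next p] permutes the vertices of the cycle. *)
  rewrite -big_mkcond /= sumrB /= [X in X - _](reindex (next p)) /=; last first.
    by exists (prev p) => x _; [rewrite prev_next|rewrite next_prev].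
  by apply/eqP; rewrite subr_eq0; apply/eqP/eq_bigl => a; rewrite mem_next.
have {}c0 e : c e = 0 by rewrite (iG c sc c0) ffunE.
(* A third vertex [z] follows [y], so the cycle does not step back from [y] to [x], and the
   coefficient of the edge joining [x] and [y] is 1 or -1. *)
have [x [y [z [q pE]]]] : exists x y z q, p = [:: x, y, z & q].
  by case: (p) p2 => [|x [|y [|z q]]] // _; exists x, y, z, q.
have := up; rewrite pE /= !inE !negb_or => /and3P[/and3P[xy xz _] _ _].
have Nxy : N (x, y) = 1 by rewrite /N pE /= !inE !eqxx.
have Nyx : N (y, x) = 0.
  by rewrite /N pE /= [y == x]eq_sym (negPf xy) eqxx [z == x]eq_sym (negPf xz) andbF.
move: cp; rewrite pE /= => /andP[/orP[] e_in _].
  have := c0 (x, y).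
  by rewrite ffunE e_in /= Nxy Nyx subr0 => /eqP; rewrite oner_eq0.
have := c0 (y, x).
by rewrite ffunE e_in /= Nxy Nyx sub0r => /eqP; rewrite oppr_eq0 oner_eq0.
Qed.

End Combination.

(** * Root cones and their subdivision by a reduction *)

Section Cone.
Variables (R : realType) (n : nat).
Local Notation E := ('I_n.+1 * 'I_n.+1)%type.
Implicit Types (c d : {ffun E -> R^o}) (G H : edgeset n) (e f : E).

Lemma root_coneP G (x : 'rV[R]_n.+1) : root_cone G x <->
  exists c, [/\ forall e, 0 <= c e, supported c G & x = comb c].
Proof.
split=> [[c [c0 ->]]|[c [c0 sc ->]]].
  exists [ffun e => if e \in G then c e else 0]; split=> [e|e /negPf eG|].
  - by rewrite ffunE; case: ifP.
  - by rewrite ffunE eG.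
  rewrite /comb big_mkcond; apply: eq_bigr => e _.
  by rewrite ffunE; case: ifP => //; rewrite scale0r.
exists c; split=> //; rewrite /comb [RHS]big_mkcond; apply: eq_bigr => e _.
by case: ifP => // /negbT/sc->; rewrite scale0r.
Qed.

Lemma sub_supported c G H : H \subset G -> supported c H -> supported c G.
Proof.
by move=> /fintype.subsetP sHG sc e eG; apply: sc; apply: contra eG => /sHG.
Qed.

Lemma sub_root_cone G H : H \subset G -> root_cone (R := R) H `<=` root_cone G.
Proof.
move=> sHG x /root_coneP[c [c0 sc ->]]; apply/root_coneP.
by exists c; split=> //; apply: sub_supported sc.
Qed.

Lemma ffunDZ c d (a : R) e : (c + a *: d) e = c e + a * d e.
Proof. by rewrite !ffunE. Qed.

Lemma root_coneZ G (a : R) x :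
  0 <= a -> root_cone G x -> root_cone G (a *: x : 'rV[R]_n.+1).
Proof.
move=> a0 /root_coneP[c [c0 sc ->]]; apply/root_coneP; exists (a *: c).
split=> [e|e /sc ce|]; last by rewrite linearZ.
  by rewrite ffunE mulr_ge0.
by rewrite ffunE ce scaler0.
Qed.

Section Reduct.
Variables (G : edgeset n) (i j k : 'I_n.+1).
Hypotheses (fG : is_forest G) (redG : reducible G i j k).

Let lt_ij : (i < j)%N. Proof. by case/and4P: redG. Qed.
Let lt_jk : (j < k)%N. Proof. by case/and4P: redG. Qed.
Let ijG : (i, j) \in G. Proof. by case/and4P: redG. Qed.
Let jkG : (j, k) \in G. Proof. by case/and4P: redG. Qed.
Let gG : is_graph G. Proof. by case: fG. Qed.
Let iG : @independent R n G. Proof. exact: forest_independent fG. Qed.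

(** The relation behind a reduction: the roots of [(i, j)] and [(j, k)] add up to that of [(i, k)].
    Adding a multiple of [rel] shifts coefficients without changing the combination. *)
Let rel : {ffun E -> R^o} :=
  edge_delta R (i, j) + edge_delta R (j, k) - edge_delta R (i, k).

Let comb_rel : comb rel = 0.
Proof.
rewrite linearB linearD /= !comb_edge_delta /pos_root /=.
by rewrite addrA subrK subrr.
Qed.

Let relE e : rel e = (e == (i, j))%:R + (e == (j, k))%:R - (e == (i, k))%:R.
Proof. by rewrite !ffunE. Qed.

Let neq_ij : (i == j) = false. Proof. by rewrite -val_eqE /= ltn_eqF. Qed.
Let neq_jk : (j == k) = false. Proof. by rewrite -val_eqE /= ltn_eqF. Qed.

Let rel_ij : rel (i, j) = 1.
Proof. by rewrite relE eqxx !xpair_eqE neq_ij neq_jk /= andbF addr0 subr0. Qed.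

Let rel_jk : rel (j, k) = 1.
Proof.
by rewrite relE eqxx !xpair_eqE [j == i]eq_sym neq_ij /= add0r subr0.
Qed.

Let rel_ik : rel (i, k) = -1.
Proof.
rewrite relE eqxx !xpair_eqE neq_ij [k == j]eq_sym neq_jk andbF /=.
by rewrite add0r sub0r.
Qed.

Let rel_notin e : e \notin G -> e != (i, k) -> rel e = 0.
Proof.
move=> eG /negPf eik; rewrite relE eik.
have -> : (e == (i, j)) = false by apply: contraNF eG => /eqP->.
have -> : (e == (j, k)) = false by apply: contraNF eG => /eqP->.
by rewrite addr0 subr0.
Qed.

Let rel_cases e : [\/ e = (i, j), e = (j, k), e = (i, k) | rel e = 0].
Proof.
rewrite relE; case: eqVneq => [->|_]; first by constructor 1.
case: eqVneq => [->|_]; first by constructor 2.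
case: eqVneq => [->|_]; first by constructor 3.
by constructor 4; rewrite addr0 subr0.
Qed.

(** Otherwise [rel] would be a nontrivial relation supported on [G]. *)
Let ikG : (i, k) \notin G.
Proof.
apply/negP => ik; have : rel = 0.
  apply: iG => // e eG; apply: rel_notin => //.
  by apply: contraNneq eG => ->.
move/(congr1 (fun c : {ffun E -> R^o} => c (i, j))) => /eqP.
by rewrite rel_ij ffunE oner_eq0.
Qed.

(** A common form of two reducts: [f = (j, k)] gives [reduct1] and [f = (i, j)] gives [reduct2]. *)
Let exch f : edgeset n := (G :\ f)%SET :|: [set (i, k)]%SET.

Let pull_supported f c : supported c (exch f) ->
  supported (c + c (i, k) *: rel) G.
Proof.
move=> sc e eG; rewrite ffunDZ; have [->|eik] := eqVneq e (i, k).
  by rewrite rel_ik mulrN1 subrr.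
by rewrite rel_notin // mulr0 addr0 sc // !inE negb_or eik (negPf eG) andbF.
Qed.

Let exch_f f : f \in G -> f \notin exch f.
Proof. by move=> fG'; rewrite !inE eqxx /=; apply: contraNneq ikG => <-. Qed.

(** Pulling a relation back to [G] gives the zero vector. Its coefficient at [f] is [c (i, k)], as
    [f] is absent from [exch f]; so [c (i, k) = 0] and the pullback was [c] itself. *)
Let exch_independent f : f \in G -> rel f = 1 -> @independent R n (exch f).
Proof.
move=> fG' rel_f c sc c0.
have /ffunP c'0 : c + c (i, k) *: rel = 0.
  apply: iG; first exact: pull_supported sc.
  by rewrite linearD linearZ /= c0 comb_rel scaler0 addr0.
have cik : c (i, k) = 0.
  have := c'0 f; rewrite ffunDZ rel_f mulr1 (sc f) ?exch_f // add0r => ->.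
  by rewrite ffunE.
by apply/ffunP => e; have := c'0 e; rewrite ffunDZ cik mul0r addr0.
Qed.

Let exch_forest f : f \in G -> rel f = 1 -> is_forest (exch f).
Proof.
move=> fG' rel_f; apply: (@independent_forest R); last exact: exch_independent.
move=> e; rewrite !inE => /orP[/andP[_ /gG//]|/eqP->] /=.
exact: ltn_trans lt_jk.
Qed.

Let card_exch f : f \in G -> #|exch f| = #|G|.
Proof.
move=> fG'; rewrite /exch finset.setUC cardsU1 (cardsD1 f G) fG' !inE.
by rewrite (negPf ikG) andbF.
Qed.

(** The amount [c f] is taken off both [(i, j)] and [(j, k)] and put on [(i, k)]. The two
    inequalities keep the coefficients nonnegative, and the one at [f] vanishes. *)
Let cone_exch f c : f \in G -> rel f = 1 ->
  (forall e, 0 <= c e) -> supported c G ->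
  c f <= c (i, j) -> c f <= c (j, k) ->
  root_cone (exch f) (comb c).
Proof.
move=> fG' rel_f c0 sc cij cjk; apply/root_coneP.
exists (c + (- c f) *: rel); split=> [e|e|].
- rewrite ffunDZ; case: (rel_cases e) => ->.
  + by rewrite rel_ij mulr1 subr_ge0.
  + by rewrite rel_jk mulr1 subr_ge0.
  + by rewrite rel_ik mulrN1 opprK addr_ge0.
  + by rewrite mulr0 addr0.
- rewrite !inE negb_or negb_and negbK => /andP[/orP[/eqP->|eG] eik].
    by rewrite ffunDZ rel_f mulr1 subrr.
  by rewrite ffunDZ sc // rel_notin // mulr0 addr0.
- by rewrite linearD linearZ /= comb_rel scaler0 addr0.
Qed.

Let cone_exch_sub f : root_cone (exch f) `<=` root_cone (R := R) G.
Proof.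
move=> x /root_coneP[c [c0 sc ->]]; apply/root_coneP.
exists (c + c (i, k) *: rel); split=> [e||].
- rewrite ffunDZ; case: (rel_cases e) => ->.
  + by rewrite rel_ij mulr1 addr_ge0.
  + by rewrite rel_jk mulr1 addr_ge0.
  + by rewrite rel_ik mulrN1 subrr.
  + by rewrite mulr0 addr0.
- exact: pull_supported sc.
- by rewrite linearD linearZ /= comb_rel scaler0 addr0.
Qed.

Lemma root_cone_reduct :
  root_cone (R := R) G =
  root_cone (reduct1 G i j k) `|` root_cone (reduct2 G i j k).
Proof.
apply/seteqP; split=> [x /root_coneP[c [c0 sc ->]]|x]; last first.
  by case=> /cone_exch_sub.
(* The edge with the smaller coefficient is the one exchanged. *)
have [le_c|/ltW le_c] := leP (c (j, k)) (c (i, j)); [left|right].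
  exact: cone_exch.
exact: cone_exch.
Qed.

Lemma sub_reduct31 : reduct3 G i j k \subset reduct1 G i j k.
Proof. by apply: finset.setSU; apply: finset.setSD; apply: subsetDl. Qed.

Lemma sub_reduct32 : reduct3 G i j k \subset reduct2 G i j k.
Proof. by apply: finset.setSU; apply: subsetDl. Qed.

Lemma root_cone_reduct3 : root_cone (R := R) (reduct3 G i j k) =
  root_cone (reduct1 G i j k) `&` root_cone (reduct2 G i j k).
Proof.
apply/seteqP; split=> [x x3|x].
  split; first exact: sub_root_cone sub_reduct31 _ x3.
  exact: sub_root_cone sub_reduct32 _ x3.
case=> /root_coneP[c [c0 sc ->]] /root_coneP[d [d0 sd cd]].
apply/root_coneP; exists c; split=> //.
(* By independence the two representations agree once pulled back to [G]. Comparing them at [(i, j)]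
   and [(j, k)] gives [c (i, j) + d (j, k) = 0], a sum of nonnegative terms, so [c] already lives on
   [reduct3]. *)
have /ffunP eq_cd : c + c (i, k) *: rel = d + d (i, k) *: rel.
  apply: (independent_inj iG); [exact: pull_supported sc|exact: pull_supported sd|].
  by rewrite linearD [RHS]linearD !linearZ /= cd comb_rel !scaler0 !addr0.
have := eq_cd (i, j); have := eq_cd (j, k); rewrite !ffunDZ rel_ij rel_jk !mulr1.
rewrite (sc (j, k)) ?(sd (i, j)) ?exch_f // !add0r => eq_jk eq_ij.
have cij : c (i, j) = 0.
  by have := c0 (i, j); have := d0 (j, k); move: eq_jk eq_ij; lra.
move=> e; have [->//|eij] := eqVneq e (i, j).
by move=> e3; apply: sc; move: e3; rewrite !inE eij.
Qed.

(* Acyclicity passes to the reducts through linear independence, which is why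
   these purely combinatorial facts mention the field [R]. *)
Lemma reduct1_forest : is_forest (reduct1 G i j k).
Proof. exact: exch_forest. Qed.

Lemma reduct2_forest : is_forest (reduct2 G i j k).
Proof. exact: exch_forest. Qed.

Lemma reduct3_forest : is_forest (reduct3 G i j k).
Proof. exact: sub_is_forest sub_reduct31 reduct1_forest. Qed.

Lemma card_reduct1 : #|reduct1 G i j k| = #|G|.
Proof. exact: card_exch. Qed.

Lemma card_reduct2 : #|reduct2 G i j k| = #|G|.
Proof. exact: card_exch. Qed.

Lemma card_reduct3 : #|reduct3 G i j k|.+1 = #|G|.
Proof.
rewrite -card_reduct1 (cardsD1 (i, j) (reduct1 G i j k)) !inE ijG.
rewrite !xpair_eqE neq_ij neq_jk /= add1n; congr _.+1.
apply: eq_card => e; rewrite !inE.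
by have [->|] := eqVneq e (i, j); rewrite //= !xpair_eqE neq_jk !andbF.
Qed.

End Reduct.
End Cone.

(** * The inequality that cuts the root polytope out of the cone *)

Section Height.
Variables (R : realType) (n : nat).
Local Notation E := ('I_n.+1 * 'I_n.+1)%type.
Local Notation V := 'rV[R]_n.+1.
Implicit Types (c : {ffun E -> R^o}) (G H : edgeset n) (x y : V).

(** On vectors with coordinate sum zero, such as every [comb c], this is half the l1 norm. *)
Definition height x : R := \sum_v Num.max (x ord0 v) 0.

Lemma heightZ a x : 0 <= a -> height (a *: x) = a * height x.
Proof.
move=> a0; rewrite /height mulr_sumr; apply: eq_bigr => v _.
by rewrite mxE maxr_pMr // mulr0.
Qed.

Lemma height_conv a b x y : 0 <= a -> 0 <= b ->
  height (a *: x + b *: y) <= a * height x + b * height y.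
Proof.
move=> a0 b0; rewrite -!heightZ // /height -big_split; apply: ler_sum => v _ /=.
by rewrite mxE ge_max lerD ?addr_ge0 // le_max lexx ?orbT.
Qed.

Lemma height_pos_root (e : E) : (e.1 < e.2)%N -> height (pos_root R e) <= 1.
Proof.
move=> lt_e; rewrite /height (bigD1 e.1) //= big1 => [|v ve].
  by rewrite pos_rootE eqxx -val_eqE /= gtn_eqF // subr0 addr0 ge_max lexx ler01.
by rewrite pos_rootE [e.1 == v]eq_sym (negPf ve) sub0r max_r // oppr_le0 ler0n.
Qed.

(** The vectors of height at most 1 form a convex set containing the generators, hence containing
    their hull. *)
Lemma height_full_root_polytope x : full_root_polytope x -> height x <= 1.
Proof.
move=> /(_ [set y | height y <= 1]); apply; split=> [y z p|_ [->|[e lt_e <-]]] /=.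
- move=> /set_mem y1 /set_mem z1; apply/mem_set => /=.
  have p0 : 0 <= p%:num :> R by [].
  have p1 : 0 <= 1 - p%:num :> R by rewrite subr_ge0.
  apply: le_trans (height_conv y z p0 p1) _.
  have := ler_wpM2l p0 y1; have := ler_wpM2l p1 z1; lra.
- by rewrite /height big1 ?ler01 // => v _; rewrite mxE maxxx.
- exact: height_pos_root.
Qed.

(* Without a vertex that is both a source and a sink nothing cancels. *)
Lemma height_alternating H c : (forall i j k, ~~ reducible H i j k) ->
  is_graph H -> (forall e, 0 <= c e) -> supported c H ->
  height (comb c) = \sum_e c e.
Proof.
move=> altH gH c0 sc.
transitivity (\sum_v \sum_e c e * (e.1 == v)%:R); last first.
  rewrite exchange_big; apply: eq_bigr => e _ /=.
  rewrite (bigD1 e.1) //= eqxx mulr1 big1 ?addr0 // => v.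
  by rewrite eq_sym => /negPf->; rewrite mulr0.
apply: eq_bigr => v _; rewrite combE.
have pos (w : E -> bool) : 0 <= \sum_e c e * (w e)%:R.
  by apply: sumr_ge0 => e _; rewrite mulr_ge0 ?ler0n.
have [/existsP[f /andP[fH /eqP fv]]|/existsPn src] :=
    boolP [exists f, (f \in H) && (f.2 == v)].
  have nosrc e : c e * (e.1 == v)%:R = 0.
    have [eH|/sc->] := boolP (e \in H); last by rewrite mul0r.
    case: eqP => [ev|_]; last by rewrite mulr0.
    have fvH : (f.1, v) \in H by rewrite -fv -surjective_pairing.
    have veH : (v, e.2) \in H by rewrite -ev -surjective_pairing.
    have := altH f.1 v e.2.
    by rewrite /reducible fvH veH (gH _ fvH) (gH _ veH).
  rewrite [RHS]big1 // max_r //.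
  by apply: sumr_le0 => e _; rewrite mulrBr nosrc sub0r oppr_le0 mulr_ge0 ?ler0n.
rewrite (eq_bigr (fun e => c e * (e.1 == v)%:R)) => [|e _]; first exact/max_l/pos.
have [eH|/sc->] := boolP (e \in H); last by rewrite !mul0r.
by have := src e; rewrite eH /= => /negPf->; rewrite subr0.
Qed.

(** Descending a reduction tree leads to a leaf whose cone contains [x], and there
    [height_alternating] applies. The coefficients obtained sit on the edges of that leaf, possibly
    outside [G]. *)
Lemma root_cone_repr G x : is_forest G -> root_cone G x ->
  exists c, [/\ forall e, 0 <= c e,
    forall e, c e != 0 -> (e.1 < e.2)%N, x = comb c & \sum_e c e = height x].
Proof.
have [T] := S_reduction_tree_exists G.
elim: {G} T => [G altG|G i j k redG T1 IH1 T2 IH2 _ _] fG.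
  move=> /root_coneP[c [c0 sc ->]]; exists c; split=> // [e|].
    by apply: contraNT => lt_e; apply/eqP/sc; apply: contra lt_e => /(fG.1).
  by apply/esym/(height_alternating altG) => //; case: fG.
rewrite (root_cone_reduct R redG) => -[].
  exact: IH1 (reduct1_forest R fG redG).
exact: IH2 (reduct2_forest R fG redG).
Qed.

(** The weight missing from 1 is carried by the origin. The induction splits off the first point and
    rescales the other weights by [1 - a i]. *)
Lemma convex_sum (M : lmodType R) (A : set (convex_lmodType M)) (I : eqType)
    (s : seq I) (a : I -> R) (v : I -> M) :
    convex_set A -> A (0 : M) -> (forall i, 0 <= a i) ->
    (forall i, i \in s -> A (v i)) -> \sum_(i <- s) a i <= 1 ->
  A (\sum_(i <- s) a i *: v i).
Proof.
move=> cA A0; elim: s a => [|i s IHs] a a0 Av; first by rewrite !big_nil.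
rewrite !big_cons => le1.
have s0 : 0 <= \sum_(j <- s) a j by exact: sumr_ge0.
have ai1 : a i <= 1 by move: le1 s0; lra.
have Avs j : j \in s -> A (v j) by move=> js; apply: Av; rewrite inE js orbT.
(* Rescaling would divide by zero here, but then all the other weights vanish. *)
have [ai|ai] := eqVneq (a i) 1.
  have /eqP : \sum_(j <- s) a j = 0 by move: le1 s0; rewrite ai; lra.
  rewrite psumr_eq0 // => /allP z; rewrite big_seq big1 => [|j js].
    by rewrite ai scale1r addr0; apply: Av; rewrite inE eqxx.
  by rewrite (eqP (z j js)) scale0r.
have lt1 : 0 < 1 - a i by rewrite subr_gt0 lt_neqAle ai.
pose b j := a j / (1 - a i).
have Aw : A (\sum_(j <- s) b j *: v j).
  apply: IHs => // [j|]; first by apply: divr_ge0 => //; exact: ltW.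
  by rewrite -mulr_suml ler_pdivrMr // mul1r; move: le1; lra.
have Avi : A (v i) by apply: Av; rewrite inE eqxx.
have := cA (v i) (\sum_(j <- s) b j *: v j) (Itv01 (a0 i) ai1).
move=> /(_ (mem_set Avi) (mem_set Aw)) /set_mem; congr (A _).
rewrite /conv /=; congr (_ + _); rewrite scaler_sumr; apply: eq_bigr => j _.
by rewrite scalerA /b mulrCA mulfV ?mulr1 // gt_eqF.
Qed.

Lemma root_cone_full G x : is_forest G -> root_cone G x -> height x <= 1 ->
  full_root_polytope x.
Proof.
move=> fG Gx x1; have [c [c0 lt_c xc hc]] := root_cone_repr fG Gx.
move=> A [cA gA].
(* Only pairs with a nonzero coefficient are known to be increasing, so only their roots are known
   to be generators. *)
pose s := [seq e <- enum {: E} | c e != 0].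
have -> : x = \sum_(e <- s) c e *: pos_root R e.
  rewrite xc /comb big_filter big_enum_cond /= [RHS]big_mkcond /=; apply: eq_bigr => e _.
  by case: eqP => [->|//]; rewrite scale0r.
apply: convex_sum => //.
- by apply: gA; left.
- move=> e; rewrite mem_filter => /andP[/lt_c lt_e _].
  by apply: gA; right; exists e.
- apply: le_trans x1; rewrite -hc big_filter big_enum_cond /= big_mkcond /=.
  by apply: ler_sum => e _; case: ifP.
Qed.

Lemma dilate_root_polytope G (t : nat) : is_forest G ->
  dilate t (root_polytope R G) = root_cone G `&` [set x | height x <= t%:R].
Proof.
move=> fG; apply/seteqP; split=> [_ [x [hx Gx] <-]|y [Gy hy]].
  split=> /=; first by apply: root_coneZ; rewrite ?ler0n.
  by rewrite heightZ ?ler0n // ler_piMr ?ler0n // height_full_root_polytope.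
have [c [c0 _ yc hc]] := root_cone_repr fG Gy.
exists (t%:R^-1 *: y); last first.
  (* For [t = 0] the inverse is 0 by convention, but a height of at most 0 forces every coefficient
     of [y], hence [y], to be zero. *)
  have [t0|t0] := eqVneq (t%:R : R) 0; last by rewrite scalerA mulfV // scale1r.
  have /eqP := hc; move: hy; rewrite /= t0 scale0r => hy0 hc0.
  have {hc0} : \sum_e c e == 0.
    by rewrite eq_le sumr_ge0 // (eqP hc0) hy0.
  rewrite psumr_eq0 // => /allP z; rewrite yc /comb big1 // => e _.
  by rewrite (eqP (z e (mem_index_enum e))) scale0r.
have t0 : 0 <= (t%:R)^-1 :> R by rewrite invr_ge0 ler0n.
have Gy' : root_cone G (t%:R^-1 *: y) by exact: root_coneZ.
split=> //; apply: root_cone_full Gy' _ => //.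
rewrite heightZ //; have [->|t1] := eqVneq t 0%N; first by rewrite invr0 mul0r ler01.
by rewrite ler_pdivrMl ?mulr1 // ltr0n lt0n.
Qed.

End Height.

(** * Counting lattice points along a reduction tree *)

Lemma index_enum_val (T : finType) (A : {pred T}) (i : 'I_#|A|) :
  index (enum_val i) (enum A) = i.
Proof.
by rewrite (enum_val_nth (enum_val i)) index_uniq ?enum_uniq // -cardE.
Qed.

Section Count.
Variables (R : realType) (n : nat).
Local Notation E := ('I_n.+1 * 'I_n.+1)%type.
Local Notation V := 'rV[R]_n.+1.
Implicit Types (c : {ffun E -> R^o}) (G H : edgeset n) (t : nat).

Definition points G t : set V :=
  dilate t (root_polytope R G) `&` lattice R n.

Section Leaf.
Variables (H : edgeset n) (t : nat).
Hypotheses (fH : is_forest H) (altH : forall i j k, ~~ reducible H i j k).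

(** Coefficients are read off a tuple in the order of [enum H], to match the tuples counted by
    [card_partial_ord_partitions]. *)
Let coef (a : #|H|.-tuple 'I_t.+1) : {ffun E -> R^o} :=
  [ffun e => if e \in H then (nth ord0 a (index e (enum H)) : nat)%:R else 0].

Let index_lt e : e \in H -> (index e (enum H) < #|H|)%N.
Proof. by move=> eH; rewrite cardE index_mem mem_enum. Qed.

Let coef_supported a : supported (coef a) H.
Proof. by move=> e /negPf eH; rewrite ffunE eH. Qed.

Let coef_ge0 a e : 0 <= coef a e.
Proof. by rewrite ffunE; case: ifP => _; rewrite ?ler0n. Qed.

Let sum_coef a : \sum_e coef a e = (\sum_(i <- a) (i : nat))%:R.
Proof.
rewrite (eq_bigr (fun e => if e \in H then coef a e else 0)) => [|e _]; last first.
  by case: ifP => // /negbT/coef_supported.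
rewrite -big_mkcond big_enum_val /= big_tuple natr_sum; apply: eq_bigr => i _.
by rewrite ffunE enum_valP index_enum_val (tnth_nth ord0).
Qed.

Let coef_inj : injective coef.
Proof.
move=> a b /ffunP ab; apply: eq_from_tnth => i; apply/val_inj => /=.
have /eqP := ab (enum_val i); rewrite !ffunE enum_valP index_enum_val eqr_nat.
by rewrite -!tnth_nth => /eqP.
Qed.

Lemma leaf_pointsE : points H t = [set` [fset comb (coef a) |
  a in [set a : #|H|.-tuple 'I_t.+1 | (\sum_(i <- a) i <= t)%N]%SET]%fset].
Proof.
have ht a := height_alternating altH fH.1 (coef_ge0 a) (@coef_supported a).
rewrite /points dilate_root_polytope //; apply/seteqP; split=> x /=.
  case=> -[/root_coneP[c [c0 sc ->]] /= +] cZ.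
  rewrite (height_alternating altH fH.1 c0 sc) => ct.
  (* Coefficients of a lattice point are integers by [forest_int_coef]. Being nonnegative with sum
     at most [t], they are naturals that fit in ['I_t.+1]. *)
  have cN e : c e = (Num.trunc (c e))%:R.
    by rewrite truncnK // natrEint (forest_int_coef fH sc cZ) c0.
  have le_t e : (Num.trunc (c e) <= t)%N.
    rewrite -(ler_nat R) -cN (le_trans _ ct) // (bigD1 e) //= lerDl.
    exact: sumr_ge0.
  pose a := [tuple (inord (Num.trunc (c (enum_val i))) : 'I_t.+1) | i < #|H|].
  have ca : coef a = c.
    apply/ffunP => e; rewrite ffunE; case: ifP => [eH|/negbT/sc//].
    have := tnth_nth ord0 a (enum_rank_in eH e).
    rewrite tnth_mktuple enum_rankK_in // => /(congr1 val) /=.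
    rewrite inordK ?ltnS // (_ : _ (enum_rank_in _ _) = index e (enum H)); last first.
      by rewrite -[in RHS](enum_rankK_in eH eH) index_enum_val.
    by move=> <-; rewrite -cN.
  apply/imfsetP; exists a; last by rewrite ca.
  by rewrite inE -(ler_nat R) -sum_coef ca.
move=> /imfsetP[a]; rewrite inE => le_a ->; split.
  split; first by apply/root_coneP; exists (coef a).
  by rewrite /= ht sum_coef ler_nat.
move=> v; rewrite combE; apply: rpred_sum => e _; apply: rpredM.
  by rewrite ffunE; case: ifP => _; rewrite ?rpred0 ?rpred_nat.
by rewrite rpredB // rpred_nat.
Qed.

Lemma leaf_points :
  finite_set (points H t) /\
  #|` fset_set (points H t)|%fset = 'C(t + #|H|, #|H|).
Proof.
rewrite leaf_pointsE; split; first exact: finite_fset.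
rewrite set_fsetK card_imfset => [|a b ab]; last first.
  exact/coef_inj/(independent_inj (forest_independent fH) _ _ ab).
by rewrite -cardE addnC card_partial_ord_partitions.
Qed.

End Leaf.

Lemma points_reduct G i j k t : is_forest G -> reducible G i j k ->
  points G t = points (reduct1 G i j k) t `|` points (reduct2 G i j k) t.
Proof.
move=> fG redG.
rewrite /points !dilate_root_polytope //;
  [|exact: (reduct2_forest R)|exact: (reduct1_forest R)].
by rewrite (root_cone_reduct R redG) !setIUl.
Qed.

Lemma points_reduct3 G i j k t : is_forest G -> reducible G i j k ->
  points (reduct3 G i j k) t =
  points (reduct1 G i j k) t `&` points (reduct2 G i j k) t.
Proof.
move=> fG redG; rewrite /points !dilate_root_polytope //;
  [|exact: (reduct2_forest R)|exact: (reduct1_forest R)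
   |exact: (reduct3_forest R)].
by rewrite (root_cone_reduct3 R fG redG) (setIIl (root_cone _)) setIIl.
Qed.

(** Induction on the tree by inclusion-exclusion. Finiteness is proved along with the count because
    [fset_set] respects unions and intersections of finite sets. *)
Lemma points_leaves G (T : S_reduction_tree G) t : is_forest G ->
  [/\ finite_set (points G t),
      forall H, H \in leaves T -> is_forest H /\ (#|H| <= #|G|)%N &
      (#|` fset_set (points G t)|%fset)%:Z * (-1) ^+ #|G| =
        \sum_(H <- leaves T) (-1) ^+ #|H| * ('C(t + #|H|, #|H|))%:Z].
Proof.
elim: {G} T => [G altG|G i j k redG T1 IH1 T2 IH2 T3 IH3] fG /=.
  have [fin card] := leaf_points t fG altG; split=> // [H|].
    by rewrite inE => /eqP->.
  by rewrite big_seq1 card mulrC.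
have [fin1 leaf1 sum1] := IH1 (reduct1_forest R fG redG).
have [fin2 leaf2 sum2] := IH2 (reduct2_forest R fG redG).
have [fin3 leaf3 sum3] := IH3 (reduct3_forest R fG redG).
have card1 := card_reduct1 R fG redG; have card2 := card_reduct2 R fG redG.
have card3 := card_reduct3 R fG redG.
rewrite card1 in leaf1 sum1; rewrite card2 in leaf2 sum2.
split=> [|H|].
- by rewrite (points_reduct t fG redG) finite_setU.
- rewrite !mem_cat => /or3P[/leaf1|/leaf2|/leaf3[fH le3]] //; split=> //.
  by rewrite -card3 ltnW.
(* Writing the edge count as that of the third reduct plus one gives this reduct the sign opposite
   to the other two, as inclusion-exclusion requires. *)
rewrite !big_cat -sum1 -sum2 -sum3 /= -card3 exprS.
have := cardfsUI (fset_set (points (reduct1 G i j k) t))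
                 (fset_set (points (reduct2 G i j k) t)).
rewrite -fset_setU // -fset_setI // -points_reduct // -points_reduct3 //.
move/(congr1 Posz); rewrite !PoszD; set s := (-1) ^+ _ => eq_card.
rewrite addrA -mulrDl -eq_card; ring.
Qed.

End Count.

(** * Grouping the leaves by their number of edges *)

(** Each [x] in [s] is counted at the single index [f x], which the bound by [l] keeps within the
    range of summation. *)
Lemma sum_count_mem (I : eqType) (s : seq I) (P : pred I) (f : I -> nat)
    (l : nat) (a : nat -> int) :
    (forall x, x \in s -> P x /\ (f x <= l)%N) ->
  \sum_(0 <= i < l.+1) a i * (count (fun x => P x && (f x == i)) s)%:Z =
  \sum_(x <- s) a (f x).
Proof.
elim: s => [|x s IHs] Ps.
  by rewrite [RHS]big_nil big1 // => i _; rewrite mulr0.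
rewrite [RHS]big_cons -IHs => [|y ys]; last by apply: Ps; rewrite inE ys orbT.
have [Px fx] := Ps x (mem_head x s).
rewrite (eq_bigr (fun i => a i * (f x == i)%:Z +
  a i * (count (fun x => P x && (f x == i)) s)%:Z)) => [|i _]; last first.
  by rewrite /= Px PoszD mulrDr.
rewrite big_split /=; congr (_ + _).
rewrite big_mkord (bigD1 (Ordinal (fx : (f x < l.+1)%N))) //= eqxx mulr1.
rewrite big1 ?addr0 // => i; rewrite -val_eqE eq_sym /= => /negPf->.
by rewrite mulr0.
Qed.

(** The finiteness conjunct ensures that [ehrhart] is the true number of lattice points, as
    [fset_set] sends infinite sets to the empty one. *)
Theorem theorem11 (R : realType) (n l : nat) (F : edgeset n)
    (F_forest : is_forest F) (F_edges : #|F| = l)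
    (T : S_reduction_tree F) (t : nat) :
  finite_set (dilate t (root_polytope R F) `&` lattice R n) /\
  (ehrhart (root_polytope R F) t)%:Z =
    (-1) ^+ l *
      \sum_(0 <= i < l.+1)
        (-1) ^+ i * (forest_leaves T i)%:Z * ('C(t + i, i))%:Z.
Proof.
have [fin leavesP sumT] := points_leaves R T t F_forest.
split=> //; rewrite F_edges in leavesP sumT.
rewrite (eq_bigr (fun i => ((-1) ^+ i * ('C(t + i, i))%:Z) *
  (count (fun H => `[< is_forest H >] && (#|H| == i)) (leaves T))%:Z)) => [|i _].
  have leP H : H \in leaves T -> `[< is_forest H >] /\ (#|H| <= l)%N.
    by move=> /leavesP[fH leH]; split=> //; apply/asboolP.
  rewrite (@sum_count_mem _ _ (fun H => `[< is_forest H >]) (fun H => #|H|) l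
    (fun i => (-1) ^+ i * ('C(t + i, i))%:Z) leP).
  by rewrite -sumT mulrCA -signr_odd -expr2 sqrr_sign mulr1.
by rewrite mulrAC.
Qed.
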